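(* Let $\mathcal{A}$ be a complex unital $C^*$-algebra and let $x,y,p,q,r,s\in\mathcal{A}$. If $x,y$ are invertible and $0\le\alpha\le1$, then for any real $n\ge2$, $$v(pxq+rys)\le\frac1n\left\|\Big(p|x^*|^{2(1-\alpha)}p^*\Big)^{\frac n2}+\Big(r|y^*|^{2(1-\alpha)}r^*\Big)^{\frac n2}\right\|+\frac{n-1}{n}\left(\Big\|q^*|x|^{2\alpha}q\Big\|^{\frac{n}{2(n-1)}}+\Big\|s^*|y|^{2\alpha}s\Big\|^{\frac{n}{2(n-1)}}\right).$$
   Context: $\mathbf 1$ is the unit of $\mathcal{A}$. $\mathcal{S}(\mathcal{A})=\{g\in\mathcal{A}^*: g(x^*x)\ge0\ \text{for all } x\in\mathcal{A},\ g(\mathbf 1)=1\}$ is the set of states and $v(x)=\sup\{|g(x)|: g\in\mathcal{S}(\mathcal{A})\}$ is the (algebraic) numerical radius. For $x\in\mathcal{A}$, $|x|=(x^*x)^{1/2}$; real powers of positive elements are defined by continuous functional calculus. *)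

(* Defs.v *)
From HB Require Import structures.
From mathcomp Require Import all_boot all_order all_algebra.
From mathcomp Require Import all_classical all_reals all_analysis.
From mathcomp Require Import complex.

Set Implicit Arguments.
Unset Strict Implicit.
Unset Printing Implicit Defensive.

Import Order.TTheory GRing.Theory Num.Theory.

Local Open Scope classical_set_scope.
Local Open Scope ring_scope.
Local Open Scope complex_scope.

(* [normc : R[i] -> R] is the modulus of a complex number. *)
Notation normc := ComplexField.Normc.normc.

(* The norm is a field of the mixin because HB cannot join [GRing.Algebra]
   with the normed modules of mathcomp-analysis ([Num.NumDomain] already
   inherits from both sides).  [GRing.Algebra] imposes [1 != 0], so the zero
   algebra, which has no state, is excluded. *)
HB.mixin Record isCstarAlgebra (R : realType) A of GRing.Algebra R[i] A := {
  cnorm : A -> R ;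
  cstar : A -> A ;
  cnormD : forall a b : A, cnorm (a + b) <= cnorm a + cnorm b ;
  cnormZ : forall (c : R[i]) (a : A), cnorm (c *: a) = normc c * cnorm a ;
  cnorm0_eq0 : forall a : A, cnorm a = 0 -> a = 0 ;
  cnormM : forall a b : A, cnorm (a * b) <= cnorm a * cnorm b ;
  cnorm_complete : forall u : nat -> A,
    (forall e : R, 0 < e -> exists N : nat, forall m n : nat,
       (N <= m)%N -> (N <= n)%N -> cnorm (u m - u n) < e) ->
    exists l : A, forall e : R, 0 < e -> exists N : nat, forall n : nat,
      (N <= n)%N -> cnorm (u n - l) < e ;
  cstarD : forall a b : A, cstar (a + b) = cstar a + cstar b ;
  cstarZ : forall (c : R[i]) (a : A), cstar (c *: a) = conjc c *: cstar a ;
  cstarM : forall a b : A, cstar (a * b) = cstar b * cstar a ;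
  cstarK : forall a : A, cstar (cstar a) = a ;
  cstar_identity : forall a : A, cnorm (cstar a * a) = cnorm a ^+ 2
}.

#[short(type="cstarAlgType")]
HB.structure Definition CstarAlgebra (R : realType) :=
  { A of isCstarAlgebra R A & GRing.Algebra R[i] A }.

Section CstarDefs.
Variables (R : realType) (A : cstarAlgType R).
Implicit Types (a : A) (f : R -> R).

Definition invertible a := exists b : A, a * b = 1 /\ b * a = 1.

Definition spectrum a : set R[i] := [set z | ~ invertible (z%:A - a)].

Definition bounded_functional (g : {scalar A}) :=
  exists M : R, forall a, normc (g a) <= M * cnorm a.

(* [0 <= z] in [R[i]] says that [z] is real and nonnegative. *)
Definition states : set {scalar A} :=
  [set g | [/\ bounded_functional g, forall a, 0 <= g (cstar a * a) & g 1 = 1]].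

Definition numradius a : R := sup [set normc (g a) | g in states].

Definition poly_calc a (p : {poly R}) : A :=
  horner_alg a (map_poly (real_complex R) p).

(* Continuous functional calculus of a self-adjoint [a], whose spectrum is
   real: [f(a)] is the norm limit of [p(a)] as the real polynomials [p]
   converge to [f] uniformly on the spectrum of [a]. *)
Definition is_cfc a f (b : A) := forall e : R, 0 < e ->
  exists p : {poly R},
    (forall t : R, spectrum a t%:C -> `|p.[t] - f t| <= e) /\
    cnorm (poly_calc a p - b) <= e.

Definition cfc a f : A := xget 0 [set b | is_cfc a f b].

Definition cpow a (t : R) : A := cfc a (fun u => u `^ t).

Definition cabs a : A := cpow (cstar a * a) 2^-1.

End CstarDefs.

(* Main.v *)
(* For a state [g] and the polar decomposition [x = u |x|], Cauchy-Schwarz with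
   [x = |x^*|^(1 - alpha) (u |x|^alpha)] gives
     |g (p x q)|^2 <= g (p |x^*|^(2 (1 - alpha)) p^* ) g (q^* |x|^(2 alpha) q).
   Young's inequality with exponents [n] and [n / (n - 1)] splits the product,
   Jensen's inequality [g a ^ (n / 2) <= g (a ^ (n / 2))] (integrate a tangent
   line) and [|g h| <= ||h||] bound the two terms, and the bounds for [x] and
   [y] add up.

   The functional calculus rests on [||h||] or [- ||h||] being in the spectrum
   of a self-adjoint [h].  This is Rickart's elementary argument: were
   [1 - h^2] invertible with [||h|| = 1], then for [s < 1] close to [1] the
   inverses of [1 - h^(2^n)] and [1 - (s h)^(2^n)] would stay close uniformly
   in [n], whereas the second tends to [1] and [||h^(2^n)|| = 1]. *)

Require Import Defs.
From mathcomp Require Import all_boot all_order all_algebra.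
From mathcomp Require Import all_classical all_reals all_analysis.
From mathcomp Require Import complex.
From mathcomp Require Import ring lra.

Set Implicit Arguments.
Unset Strict Implicit.
Unset Printing Implicit Defensive.

Import Order.TTheory GRing.Theory Num.Theory.
Import numFieldNormedType.Exports.

Local Open Scope classical_set_scope.
Local Open Scope ring_scope.
Local Open Scope complex_scope.

(** * Inverses in a ring and small real numbers *)

Definition inverse_of (A : nzRingType) (a b : A) := a * b = 1 /\ b * a = 1.

Lemma inverse_ofC (A : nzRingType) (a b : A) : inverse_of a b -> inverse_of b a.
Proof. by case. Qed.

Lemma inverse_ofM (A : nzRingType) (a a' b b' : A) :
  inverse_of a a' -> inverse_of b b' -> inverse_of (a * b) (b' * a').
Proof.
move=> [aa a'a] [bb b'b]; split.
  by rewrite mulrA -(mulrA a) bb mulr1.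
by rewrite mulrA -(mulrA b') a'a mulr1.
Qed.

Lemma inverse_of_comm (A : nzRingType) (a a' c : A) :
  inverse_of a a' -> GRing.comm c a -> GRing.comm c a'.
Proof.
move=> [aa a'a] ca; rewrite /GRing.comm.
by rewrite -[LHS]mul1r -{1}a'a -!mulrA (mulrA a) -ca -mulrA aa mulr1.
Qed.

Lemma normc_real (R : realType) (t : R) : normc t%:C = `|t|.
Proof. by rewrite /= expr0n /= addr0 sqrtr_sqr. Qed.

Lemma le0_small (R : realType) (x : R) : (forall e, 0 < e -> x <= e) -> x <= 0.
Proof.
move=> h; rewrite leNgt; apply/negP => x0.
have := h (x / 2) (divr_gt0 x0 (ltr0n _ 2)); lra.
Qed.

Lemma exprn_small (R : realType) (r e : R) : 0 <= r < 1 -> 0 < e ->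
  exists N, forall n, (N <= n)%N -> r ^+ n < e.
Proof.
move=> /andP[r0 r1] e0.
have /cvg_expr/cvgrPdist_lt/(_ _ e0)[N _ hN] : `|r| < 1 by rewrite ger0_norm.
exists N => n Nn; have := hN n Nn.
by rewrite sub0r normrN ger0_norm// exprn_ge0.
Qed.

Lemma subr1_sqr (A : nzRingType) (a : A) : 1 - a ^+ 2 = (1 - a) * (1 + a).
Proof. by rewrite -opprB subr_sqr_1 -mulNr opprB addrC [1 + a]addrC. Qed.

(** * Norm, inverses and spectral radius *)

Section Norm.
Variables (R : realType) (A : cstarAlgType R).
Implicit Types a b c h g : A.

Lemma cnorm0 : cnorm (0 : A) = 0.
Proof. by rewrite -(scale0r (0 : A)) cnormZ /= expr0n /= addr0 sqrtr0 mul0r. Qed.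

Lemma cnormN a : cnorm (- a) = cnorm a.
Proof.
by rewrite -scaleN1r cnormZ -(rmorph1 (real_complex R)) -rmorphN normc_real
  normrN normr1 mul1r.
Qed.

Lemma cnorm_ge0 a : 0 <= cnorm a.
Proof. by have := cnormD a (- a); rewrite subrr cnorm0 cnormN; lra. Qed.

Lemma cnormB a b : cnorm (a - b) <= cnorm a + cnorm b.
Proof. by rewrite -(cnormN b) cnormD. Qed.

Lemma cdistC a b : cnorm (a - b) = cnorm (b - a).
Proof. by rewrite -cnormN opprB. Qed.

Lemma cdist_tri b a c : cnorm (a - c) <= cnorm (a - b) + cnorm (b - c).
Proof. by rewrite -[a - c](subrKA b) cnormD. Qed.

Lemma cnorm_small a : (forall e, 0 < e -> cnorm a <= e) -> a = 0.
Proof.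
move=> /le0_small a0; apply: cnorm0_eq0; apply/eqP.
by rewrite eq_le a0 cnorm_ge0.
Qed.

Lemma cdist_small a b : (forall e, 0 < e -> cnorm (a - b) <= e) -> a = b.
Proof. by move=> /cnorm_small/subr0_eq. Qed.

Lemma cstar0 : cstar (0 : A) = 0.
Proof. by rewrite -(scale0r (0 : A)) cstarZ conjc0 !scale0r. Qed.

Lemma cstarN a : cstar (- a) = - cstar a.
Proof. by apply/eqP; rewrite -addr_eq0 -cstarD addNr cstar0. Qed.

Lemma cstarB a b : cstar (a - b) = cstar a - cstar b.
Proof. by rewrite cstarD cstarN. Qed.

Lemma cstar1 : cstar (1 : A) = 1.
Proof. by have := cstarM 1 (cstar (1 : A)); rewrite mul1r cstarK mul1r. Qed.

Lemma cnorm1 : cnorm (1 : A) = 1.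
Proof.
have := cstar_identity (1 : A); rewrite cstar1 mulr1.
have /eqP n0 : cnorm (1 : A) <> 0 by move=> /cnorm0_eq0/eqP; rewrite oner_eq0.
by move=> /eqP; rewrite expr2 -{1}(mulr1 (cnorm _)) (inj_eq (mulfI n0)) => /eqP.
Qed.

(** The C*-identity gives [||b||^2 = ||b^* b|| <= ||b^*|| ||b||]; applying this to [b] and to [b^*]
    yields both inequalities. *)
Lemma cnorm_star a : cnorm (cstar a) = cnorm a.
Proof.
suff le b : cnorm b <= cnorm (cstar b).
  by apply: le_anti; rewrite le -{2}(cstarK a) le.
have [b0|b0] := eqVneq (cnorm b) 0; first by rewrite b0 cnorm_ge0.
have b1 : 0 < cnorm b by rewrite lt_def b0 cnorm_ge0.
by rewrite -(ler_pM2r b1) -expr2 -cstar_identity cnormM.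
Qed.

Lemma cnorm_scalar (z : R[i]) : cnorm (z%:A : A) = normc z.
Proof. by rewrite cnormZ cnorm1 mulr1. Qed.

Lemma cnormZr (t : R) a : cnorm (t%:C *: a) = `|t| * cnorm a.
Proof. by rewrite cnormZ normc_real. Qed.

Definition self_adjoint a := cstar a = a.

Lemma self_adjointD a b :
  self_adjoint a -> self_adjoint b -> self_adjoint (a + b).
Proof. by rewrite /self_adjoint cstarD => -> ->. Qed.

Lemma self_adjointZ (t : R) a : self_adjoint a -> self_adjoint (t%:C *: a).
Proof. by rewrite /self_adjoint cstarZ conjc_real => ->. Qed.

Lemma self_adjoint1 : self_adjoint 1.
Proof. exact: cstar1. Qed.

Lemma self_adjoint_sqr a : self_adjoint a -> self_adjoint (a ^+ 2).
Proof. by rewrite /self_adjoint expr2 cstarM => ->. Qed.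

Lemma self_adjoint_starM a : self_adjoint (cstar a * a).
Proof. by rewrite /self_adjoint cstarM cstarK. Qed.

Lemma cnorm_sqr h : self_adjoint h -> cnorm (h ^+ 2) = cnorm h ^+ 2.
Proof. by move=> hs; rewrite -[in RHS]cstar_identity hs. Qed.

(** From [(1 - a) b = 1] follows [b - 1 = a (b - 1) + a]. The product form avoids division. *)
Lemma cnorm_inverse_bound a b (r : R) : cnorm a <= r -> r < 1 ->
  inverse_of (1 - a) b -> cnorm (b - 1) * (1 - r) <= r.
Proof.
move=> ar r1 [ab _].
have b1 : b - 1 = a * (b - 1) + a.
  by rewrite mulrBr mulr1 subrK -ab mulrBl mul1r subKr.
have := cnormD (a * (b - 1)) a; rewrite -b1.
have := cnormM a (b - 1); have := cnorm_ge0 (b - 1); nra.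
Qed.

(** The inverse is the sum of the geometric series, whose partial sums satisfy
    [(1 - a) * S n = 1 - a ^+ n]. *)
Lemma neumann a : cnorm a < 1 -> exists b, inverse_of (1 - a) b.
Proof.
move=> a1; set r := cnorm a in a1; have r0 : 0 <= r := cnorm_ge0 a.
have normX n : cnorm (a ^+ n) <= r ^+ n.
  elim: n => [|n IHn]; first by rewrite !expr0 cnorm1.
  by rewrite !exprS (le_trans (cnormM _ _))// ler_wpM2l.
pose S n : A := \sum_(i < n) a ^+ i.
(* Multiplying by [1 - r] telescopes the geometric tail. *)
have tail n k : (1 - r) * cnorm (S (n + k)%N - S n) <= r ^+ n - r ^+ (n + k).
  elim: k => [|k IHk]; first by rewrite addn0 !subrr cnorm0 mulr0.
  rewrite addnS /S big_ord_recr /= addrAC.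
  apply: (@le_trans _ _ ((1 - r) * (cnorm (S (n + k)%N - S n) + r ^+ (n + k)))).
    by rewrite ler_pM2l ?subr_gt0// (le_trans (cnormD _ _))// lerD2l.
  by rewrite exprS; lra.
have small e : 0 < e -> exists N : nat, forall n k,
    (N <= n)%N -> cnorm (S (n + k)%N - S n) < e.
  move=> e0; have e1 : 0 < (1 - r) * e by rewrite mulr_gt0// subr_gt0.
  have [N hN] := exprn_small (introT andP (conj r0 a1)) e1.
  exists N => n k Nn; have := tail n k; have := hN _ Nn.
  have : 0 <= r ^+ (n + k) by rewrite exprn_ge0.
  move=> p1 p2 p3; rewrite -(@ltr_pM2l _ (1 - r)) ?subr_gt0//; lra.
have [l hl] : exists l : A, forall e : R, 0 < e -> exists N : nat,
    forall n : nat, (N <= n)%N -> cnorm (S n - l) < e.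
  apply: cnorm_complete => e /small[N hN]; exists N => m n Nm Nn.
  have [mn|/ltnW nm] := leqP m n.
    by rewrite cdistC -(subnKC mn) hN.
  by rewrite -(subnKC nm) hN.
(* Passage to the limit under a bounded additive [f], used below for left and for right
   multiplication by [1 - a]. *)
have lim (f : A -> A) K : (forall x y, f (x - y) = f x - f y) ->
    (forall x, cnorm (f x) <= K * cnorm x) -> 0 <= K ->
    (forall n, f (S n) = 1 - a ^+ n) -> f l = 1.
  move=> fB fK K0 fS; apply: cdist_small => e e0.
  have e2 : 0 < e / 2 by lra.
  have [N1 h1] := exprn_small (introT andP (conj r0 a1)) e2.
  have e3 : 0 < e / 2 / (K + 1) by rewrite divr_gt0//; lra.
  have [N2 h2] := hl _ e3.
  pose n := maxn N1 N2; have := h1 n (leq_maxl _ _).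
  have := h2 n (leq_maxr _ _); rewrite (@ltr_pdivlMr _ (K + 1)); last lra.
  have := cdist_tri (f (S n)) (f l) 1.
  rewrite -fB cdistC -opprB cnormN fS addrAC subrr sub0r cnormN.
  have := normX n; have := fK (l - S n); rewrite (cdistC l).
  have := cnorm_ge0 (S n - l); nra.
have geo n : S n.+1 = 1 + a * S n /\ S n.+1 = S n + a ^+ n.
  split; last by rewrite /S big_ord_recr.
  rewrite /S big_ord_recl expr0 big_distrr /=; congr (_ + _).
  by apply: eq_bigr => i _; rewrite exprS.
have geo1 n : (1 - a) * S n = 1 - a ^+ n.
  have [h1 h2] := geo n; rewrite mulrBl mul1r.
  by apply/eqP; rewrite subr_eq addrAC -h1 h2 addrK.
have comm n : S n * a = a * S n.
  rewrite /S big_distrl big_distrr /=; apply: eq_bigr => i _.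
  by rewrite -exprS exprSr.
exists l; split.
  apply: (@lim (fun x => (1 - a) * x) (cnorm (1 - a))) => //.
  - by move=> x y; rewrite mulrBr.
  - by move=> x; exact: cnormM.
  - exact: cnorm_ge0.
apply: (@lim (fun x => x * (1 - a)) (cnorm (1 - a))) => //.
- by move=> x y; rewrite mulrBl.
- by move=> x; rewrite mulrC; exact: cnormM.
- exact: cnorm_ge0.
- by move=> n; rewrite mulrBr mulr1 comm -geo1 mulrBl mul1r.
Qed.

Lemma inverse_ofZ (z : R[i]) a b : z != 0 ->
  inverse_of a b -> inverse_of (z *: a) (z^-1 *: b).
Proof.
move=> z0 [ab ba].
by split; rewrite -scalerAl -scalerAr scalerA ?ab ?ba ?divff ?mulVf// scale1r.
Qed.

Lemma invertibleN a : invertible a -> invertible (- a).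
Proof. by move=> [b [ab ba]]; exists (- b); rewrite !mulrNN. Qed.

Lemma normc_gt0 (z : R[i]) : 0 < normc z -> z != 0.
Proof. by apply: contraTneq => ->; rewrite ComplexField.Normc.normc0 ltxx. Qed.

(** Factor out [z] and apply the Neumann series to [z^-1 a]. *)
Lemma invertible_resolvent (z : R[i]) a :
  cnorm a < normc z -> invertible (z%:A - a).
Proof.
move=> az; have z0 : 0 < normc z := le_lt_trans (cnorm_ge0 a) az.
have zn := normc_gt0 z0.
have [|b hb] := @neumann (z^-1 *: a).
  by rewrite cnormZ ComplexField.Normc.normcV mulrC ltr_pdivrMr// mul1r.
exists (z^-1 *: b); have := inverse_ofZ zn hb.
by rewrite scalerBr scalerA divff// scale1r.
Qed.

Lemma shiftM (z w : R[i]) a :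
  (a + z%:A) * (a + w%:A) = a ^+ 2 + (z + w) *: a + (z * w)%:A.
Proof.
rewrite mulrDl !mulrDr -!scalerAl -!scalerAr !mul1r !mulr1 scalerA.
by rewrite -expr2 scalerDl -!addrA; congr (_ + _); rewrite addrCA.
Qed.

(* Shift by [i t]: [||h + i t||^2 <= ||h||^2 + t^2 < |x + i (y + t)|^2]. *)
Lemma self_adjoint_resolvent h (x y : R) : self_adjoint h -> y != 0 ->
  invertible ((x +i* y)%:A - h).
Proof.
(* This [t] solves [2 y t = ||h||^2], so [(y + t)^2 = y^2 + ||h||^2 + t^2]; the surplus [y^2 > 0]
   makes the inequality strict. *)
move=> hs y0; set t := cnorm h ^+ 2 / (2 * y).
have -> : (x +i* y)%:A - h =
    (x +i* (y + t))%:A - (h + (0 +i* t)%:A).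
  have -> : x +i* (y + t) = x +i* y + 0 +i* t.
    by apply/eqP; rewrite eq_complex /= addr0 !eqxx.
  by rewrite scalerDl opprD addrACA subrr addr0.
apply: invertible_resolvent.
rewrite -(@ltr_pXn2r _ 2)// ?nnegrE ?cnorm_ge0 ?sqrtr_ge0//.
rewrite -cstar_identity cstarD hs cstarZ cstar1.
have -> : (h + (0 +i* t)^*%:A) * (h + (0 +i* t)%:A) = h ^+ 2 + (t ^+ 2)%:C%:A.
  rewrite shiftM.
  have -> : (0 +i* t)^* + 0 +i* t = 0.
    by apply/eqP; rewrite eq_complex /= addr0 addNr !eqxx.
  rewrite scale0r addr0; congr (_ + _ *: _).
  apply/eqP; rewrite eq_complex /= !mulr0 !mul0r addr0 sub0r mulNr opprK.
  by rewrite expr2 !eqxx.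
rewrite (le_lt_trans (cnormD _ _))// cnorm_sqr// cnorm_scalar normc_real.
rewrite /= sqr_sqrtr ?addr_ge0 ?sqr_ge0// ger0_norm ?sqr_ge0//.
have e : (y + t) ^+ 2 = y ^+ 2 + cnorm h ^+ 2 + t ^+ 2 by rewrite /t; field.
have : 0 < y ^+ 2 by rewrite exprn_even_gt0.
by rewrite e; have := sqr_ge0 x; lra.
Qed.

(** [1 + h^2 = (h + i) (h - i)], and both factors are invertible because the spectrum of a
    self-adjoint element is real. *)
Lemma inverse_1Dsqr h : self_adjoint h -> exists w, inverse_of (1 + h ^+ 2) w.
Proof.
move=> hs; have res (y : R) : y != 0 -> exists b, inverse_of (h + (0 +i* y)%:A) b.
  move=> y0; have [|b hb] := @self_adjoint_resolvent h 0 (- y) hs.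
    by rewrite oppr_eq0.
  exists (- b); move: hb; rewrite /inverse_of.
  have -> : (0 +i* (- y))%:A - h = - (h + (0 +i* y)%:A).
    rewrite opprD addrC -scaleNr; congr (_ + _ *: _).
    by apply/eqP; rewrite eq_complex /= oppr0 !eqxx.
  by rewrite !mulNr !mulrN.
have [b hb] := res 1 (oner_neq0 _).
have [|c hc] := res (-1); first by rewrite oppr_eq0 oner_neq0.
exists (c * b); have := inverse_ofM hb hc.
rewrite shiftM addrC.
have -> : 0 +i* 1 + 0 +i* (-1) = 0 :> R[i].
  by apply/eqP; rewrite eq_complex /= addr0 subrr !eqxx.
have -> : (0 +i* 1) * (0 +i* (-1)) = 1 :> R[i].
  apply/eqP; rewrite eq_complex /= !mulr0 mul0r mulrN mulr1 opprK.
  by rewrite add0r addr0 !eqxx.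
by rewrite scale0r scale1r addr0.
Qed.

Lemma inverse_of_unique a b c : inverse_of a b -> inverse_of a c -> b = c.
Proof. by move=> [_ ba] [ac _]; rewrite -[b]mulr1 -ac mulrA ba mul1r. Qed.

Lemma self_adjoint_inverse a b : self_adjoint a -> inverse_of a b -> self_adjoint b.
Proof.
move=> sa [ab ba]; apply: (@inverse_of_unique a); last by [].
by split; rewrite -{1}sa -cstarM ?ab ?ba cstar1.
Qed.

(* [(1 - h^2) w] is the real part of the unitary [u = (1 + i h)^2 w]. *)
Lemma cayley_bound h w : self_adjoint h -> inverse_of (1 + h ^+ 2) w ->
  cnorm ((1 - h ^+ 2) * w) <= 1.
Proof.
move=> hs iw; have ws : self_adjoint w.
  exact: self_adjoint_inverse (self_adjointD self_adjoint1 (self_adjoint_sqr hs)) iw.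
have hw : GRing.comm h w.
  apply: inverse_of_comm iw _; apply: commrD; first exact: commr1.
  exact: commrX.
have kw : GRing.comm (1 - h ^+ 2) w.
  apply/commr_sym/commrB; first exact: commr1.
  exact/commrX/commr_sym.
set z := _ * w; pose y := h *+ 2 * w.
have zs : self_adjoint z.
  by rewrite /self_adjoint /z cstarM ws cstarB cstar1 (self_adjoint_sqr hs) kw.
have ys : self_adjoint y.
  by rewrite /self_adjoint /y cstarM ws mulr2n cstarD hs -mulr2n mulrnAr
    mulrnAl hw.
have zy : GRing.comm z y.
  have kh : GRing.comm (1 - h ^+ 2) (h *+ 2).
    apply: commrMn; apply/commr_sym/commrB; [exact: commr1|exact: commrX].
  have wh : GRing.comm w (h *+ 2) by apply/commrMn/commr_sym.
  apply: commrM; apply/commr_sym/commrM; apply/commr_sym => //.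
(* This is [(1 - h^2)^2 + (2 h)^2 = (1 + h^2)^2] multiplied by [w^2]; it gives [u^* u = 1] below. *)
have zy1 : z ^+ 2 + y ^+ 2 = 1.
  rewrite /z /y !exprMn_comm//; last exact/commr_sym/commrMn/commr_sym.
  rewrite -mulrDl -[(1 - _) ^+ 2]sqrrN opprB sqrrB1.
  have -> : (h ^+ 2) ^+ 2 - h ^+ 2 *+ 2 + 1 + (h *+ 2) ^+ 2 = (h ^+ 2 + 1) ^+ 2.
    rewrite sqrrD1 addrAC; congr (_ + _); rewrite -addrA; congr (_ + _).
    by rewrite exprMn_n -[(2 ^ 2)%N]/(2 + 2)%N mulrnDr addrA addNr add0r.
  case: iw => iw1 _; rewrite (addrC _ 1) -exprMn_comm; last first.
    by apply/commr_sym/commrD; [exact: commr1|exact/commrX/commr_sym].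
  by rewrite iw1 expr1n.
pose u := z + 'i *: y.
have us : cstar u = z - 'i *: y.
  rewrite cstarD cstarZ zs ys -scaleNr; congr (_ + _ *: _).
  by apply/eqP; rewrite eq_complex /= oppr0 !eqxx.
have u1 : cnorm u = 1.
  apply/eqP; rewrite -(@eqrXn2 _ 2)// ?cnorm_ge0// expr1n -cstar_identity us.
  rewrite mulrBl !mulrDr -!scalerAl -!scalerAr scalerA -expr2 -expr2 sqr_i scaleN1r.
  by rewrite zy -addrA subKr -[y * y]expr2 zy1 cnorm1.
have : 2 * cnorm z <= 2.
  have -> : 2 * cnorm z = cnorm (u + cstar u).
    rewrite us addrACA subrr addr0 -mulr2n -[z *+ 2]scaler_nat cnormZ.
    by rewrite -(rmorph_nat (real_complex R) 2) normc_real ger0_norm.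
  by rewrite (le_trans (cnormD _ _))// cnorm_star u1.
by move=> z2; lra.
Qed.

Lemma resolvent_sub a b a' b' : inverse_of a a' -> inverse_of b b' ->
  a' - b' = a' * (b - a) * b'.
Proof.
move=> [_ aa] [bb _].
by rewrite mulrBr mulrBl -mulrA bb mulr1 aa mul1r.
Qed.

(* [1 / (1 - v ^ 2)] is the average of [1 / (1 - v)] and [1 / (1 + v)], and the
   Cayley transform bounds the variation of the second term by that of the
   first. *)
Lemma resolvent_sqr_contract h g x y : self_adjoint h -> self_adjoint g ->
  inverse_of (1 - h ^+ 2) x -> inverse_of (1 - g ^+ 2) y ->
  exists x' y', [/\ inverse_of (1 - (h ^+ 2) ^+ 2) x',
    inverse_of (1 - (g ^+ 2) ^+ 2) y' & cnorm (x' - y') <= cnorm (x - y)].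
Proof.
move=> hs gs ix iy.
have [v iv] := inverse_1Dsqr hs; have [w iw] := inverse_1Dsqr gs.
(* Partial fractions: the commuting inverses [b] and [c] satisfy [b + c = 2 b c]. *)
have sqr a b c : inverse_of (1 - a ^+ 2) b -> inverse_of (1 + a ^+ 2) c ->
    inverse_of (1 - (a ^+ 2) ^+ 2) ((2^-1)%:C *: (b + c)).
  move=> ib ic; have -> : (2^-1)%:C *: (b + c) = c * b.
    have : b * ((1 + a ^+ 2) + (1 - a ^+ 2)) * c = b + c.
      case: ib ic => [_ bb] [cc _].
      by rewrite mulrDr mulrDl -mulrA cc mulr1 bb mul1r.
    rewrite addrACA subrr addr0 -mulr2n mulr_natr mulrnAl => <-.
    have bc : GRing.comm b c.
      apply: inverse_of_comm ic _; apply/commr_sym; apply: inverse_of_comm ib _.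
      apply: commrB; first exact: commr1.
      by apply/commr_sym/commrD; [exact: commr1|].
    rewrite -bc -[b * c *+ 2]scaler_nat scalerA -(rmorph_nat (real_complex R) 2).
    by rewrite -rmorphM mulVf ?pnatr_eq0// scale1r.
  by rewrite subr1_sqr; exact: inverse_ofM.
exists ((2^-1)%:C *: (x + v)), ((2^-1)%:C *: (y + w)).
split; [exact: sqr|exact: sqr|].
rewrite -scalerBr opprD addrACA cnormZr ger0_norm ?invr_ge0//.
suff vw : cnorm (v - w) <= cnorm (x - y).
  by rewrite mulrC ler_pdivrMr// (le_trans (cnormD _ _))//; lra.
have xy : (g ^+ 2 - h ^+ 2) = - ((1 - h ^+ 2) * (x - y) * (1 - g ^+ 2)).
  rewrite (resolvent_sub ix iy); case: ix iy => [x1 _] [_ y1].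
  rewrite !mulrA x1 mul1r -mulrA y1 mulr1.
  by rewrite opprB [RHS]addrC opprB subrKA.
(* The outer factors are the two Cayley transforms, each of norm at most 1. *)
have -> : v - w = - (((1 - h ^+ 2) * v) * (x - y) * ((1 - g ^+ 2) * w)).
  rewrite (resolvent_sub iv iw) opprD addrACA subrr add0r xy.
  have -> : (1 - h ^+ 2) * v = v * (1 - h ^+ 2).
    apply: inverse_of_comm iv _; apply/commrD; first exact: commr1.
    by apply/commr_sym/commrB; [exact: commr1|].
  by rewrite mulrN mulNr !mulrA.
rewrite cnormN (le_trans (cnormM _ _))// -[leRHS]mulr1.
rewrite ler_pM ?cnorm_ge0 ?(cayley_bound gs)//.
rewrite (le_trans (cnormM _ _))// -[leRHS]mul1r.
by rewrite ler_wpM2r ?cnorm_ge0 ?(cayley_bound hs).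
Qed.

(** Continuity of inversion at [1 - h^2], approached along [s h] with [s < 1]. *)
Lemma resolvent_near h x e : cnorm (h ^+ 2) <= 1 -> inverse_of (1 - h ^+ 2) x ->
  0 < e -> exists s y, [/\ 0 <= s < 1,
    inverse_of (1 - (s%:C *: h) ^+ 2) y & cnorm (x - y) <= e].
Proof.
move=> k1 ix e0; set k := h ^+ 2 in k1 ix *.
set C := cnorm x; have C0 : 0 <= C := cnorm_ge0 _.
(* With [s^2 = 1 - n], the distance [d' = ||x - y||] satisfies [d' <= n C (C + d')]. The three
   bounds on [n] keep [1 - n] positive, absorb [n C d'] into the left side, and give [2 n C^2 <= e].
   Using [C + 1] avoids dividing by zero. *)
pose n := Num.min (1 / 2) (Num.min (2^-1 / (C + 1)) (e / (2 * (C + 1) ^+ 2))).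
have C1 : 0 < C + 1 by lra.
have n0 : 0 < n by rewrite !lt_min !divr_gt0// ?mulr_gt0// ?exprn_gt0// ?invr_gt0.
have n1 : n <= 1 / 2 by rewrite ge_min lexx.
have n2 : n * (C + 1) <= 2^-1.
  by rewrite -ler_pdivlMr// !ge_min lexx ?orbT.
have n3 : n * (2 * (C + 1) ^+ 2) <= e.
  by rewrite -ler_pdivlMr ?mulr_gt0 ?exprn_gt0// !ge_min lexx ?orbT.
have s1 : 0 <= Num.sqrt (1 - n) < 1.
  by rewrite sqrtr_ge0 /= -{2}sqrtr1 ltr_sqrt; lra.
have s2 : Num.sqrt (1 - n) ^+ 2 = 1 - n by rewrite sqr_sqrtr//; lra.
have sk : (((Num.sqrt (1 - n))%:C *: h) ^+ 2 : A) = (1 - n)%:C *: k.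
  by rewrite exprZn -rmorphXn s2.
have [|y iy] := @neumann ((1 - n)%:C *: k).
  by rewrite cnormZr ger0_norm; have := cnorm_ge0 k; nra.
exists (Num.sqrt (1 - n)), y; split => //; first by rewrite sk.
have d : x - y = n%:C *: (x * k * y).
  rewrite (resolvent_sub ix iy) opprD opprK addrACA subrr add0r.
  rewrite rmorphB rmorph1 scalerBl scale1r opprB addrC subrKC.
  by rewrite -scalerAr -scalerAl.
have := cdist_tri 0 y x; have := cnormB x (x - y); rewrite subKr => y1 _.
have : cnorm (x - y) <= n * (C * (C + cnorm (x - y))).
  rewrite [leLHS](_ : _ = n * cnorm (x * k * y)); last first.
    by rewrite {1}d cnormZr ger0_norm// ltW.
  rewrite ler_pM2l// -mulrA.
  rewrite (le_trans (cnormM _ _))// ler_wpM2l//.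
  rewrite (le_trans (cnormM _ _))//; have := cnorm_ge0 y; have := cnorm_ge0 k.
  by rewrite -/C in y1; nra.
have := cnorm_ge0 (x - y); move: (cnorm (x - y)) => d' d0 dn.
have nC : n * C <= 2^-1 by nra.
have : d' <= 2 * (n * C * C) by nra.
by move=> /le_trans; apply; nra.
Qed.

Lemma invertible_1Bsqr_lt1 h : self_adjoint h -> cnorm h <= 1 ->
  invertible (1 - h ^+ 2) -> cnorm h < 1.
Proof.
move=> hs h1 [x ix]; rewrite lt_neqAle h1 andbT; apply/eqP => {}h1.
have [||s [y [/andP[s0 s1] iy xy]]] := @resolvent_near h x (8^-1) _ ix _.
- by rewrite cnorm_sqr// h1 expr1n.
- by rewrite invr_gt0.
(* Repeated squaring keeps the first norm at 1 and the distance of the inverses at most 1/8, while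
   the second norm decays; the crude rate [s ^+ n.+1] suffices. *)
have iter n : exists h' g' x' y', [/\ self_adjoint h', self_adjoint g',
    inverse_of (1 - h' ^+ 2) x', inverse_of (1 - g' ^+ 2) y'
    & [/\ cnorm h' = 1, cnorm g' <= s ^+ n.+1 & cnorm (x' - y') <= 8^-1]].
  elim: n => [|n [h' [g' [x' [y' [hs' gs' ix' iy' [h1' g1' xy']]]]]]].
    exists h, (s%:C *: h), x, y; split => //; first exact: self_adjointZ.
    by split => //; rewrite cnormZr h1 mulr1 expr1 ger0_norm.
  have [x2 [y2 [ix2 iy2 xy2]]] := resolvent_sqr_contract hs' gs' ix' iy'.
  exists (h' ^+ 2), (g' ^+ 2), x2, y2; split => //; try exact: self_adjoint_sqr.
  split; [by rewrite cnorm_sqr// h1' expr1n| |exact: le_trans xy2 xy'].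
  rewrite cnorm_sqr// [s ^+ n.+2]exprS expr2 ler_pM ?cnorm_ge0//.
  rewrite (le_trans g1')// exprS -[leRHS]mulr1 ler_wpM2l//.
  by rewrite exprn_ile1// ltW.
have [|N hN] := @exprn_small _ s (8^-1) (introT andP (conj s0 s1)).
  by rewrite invr_gt0.
have [h' [g' [x' [y' [hs' gs' ix' iy' [h1' g1' xy']]]]]] := iter N.
have g8 : cnorm (g' ^+ 2) <= 8^-1.
  have := hN N.+1 (leqnSn _); rewrite cnorm_sqr//; have := cnorm_ge0 g'; nra.
have y1 : cnorm (y' - 1) * (1 - 8^-1) <= 8^-1.
  by apply: cnorm_inverse_bound g8 _ iy'; lra.
(* [1/8 + 1/7 < 1/3]. Then [1 - h' ^+ 2], the inverse of [x'], lies within 1/2 of 1, against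
   [||h' ^+ 2|| = 1]. *)
have x1 : cnorm (1 - x') <= 3^-1.
  by have := cdist_tri y' x' 1; rewrite (cdistC 1 x'); lra.
have : cnorm (1 - h' ^+ 2 - 1) * (1 - 3^-1) <= 3^-1.
  apply: cnorm_inverse_bound x1 _ _; first lra.
  by rewrite subKr; exact: inverse_ofC.
by rewrite addrAC subrr sub0r cnormN cnorm_sqr// h1' expr1n; lra.
Qed.

(** Were neither value spectral, then for [k = h / ||h||] the product [1 - k^2 = (1 - k) (1 + k)]
    would be invertible, forcing [||k|| < 1]. *)
Lemma cnorm_spectrum h : self_adjoint h ->
  spectrum h (cnorm h)%:C \/ spectrum h (- cnorm h)%:C.
Proof.
move=> hs; apply: contrapT => /not_orP[/contrapT i1 /contrapT i2].
set M := cnorm h in i1 i2.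
(* For [h = 0] no scaling is possible, but 0 is spectral since [1 != 0]. *)
have [M0|M0] := eqVneq M 0.
  have h0 : h = 0 by apply: cnorm0_eq0.
  case: i1 => b []; rewrite M0 h0 scale0r subrr mul0r => /eqP.
  by rewrite eq_sym oner_eq0.
have Mp : 0 < M by rewrite lt_def M0 cnorm_ge0.
have MC : M%:C != 0 by apply: normc_gt0; rewrite normc_real normr_gt0.
have k1 : cnorm (M^-1%:C *: h) = 1.
  by rewrite cnormZr gtr0_norm ?invr_gt0// mulVf.
suff : cnorm (M^-1%:C *: h) < 1 by rewrite k1 ltxx.
apply: invertible_1Bsqr_lt1; rewrite ?k1//; first exact: self_adjointZ.
have [b ib] := i1; have [c ic] := i2.
have := inverse_ofZ (invr_neq0 MC) ib; have := inverse_ofZ (invr_neq0 MC) ic.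
have fi : real_complex R M^-1 = M%:C^-1 by rewrite fmorphV.
rewrite !scalerBr !scalerA rmorphN mulrN mulVf// scale1r scaleN1r -fi.
set k := _ *: h => ic' ib'.
exists ((- (M^-1%:C^-1 *: c)) * (M^-1%:C^-1 *: b)).
rewrite subr1_sqr; suff ic2 : inverse_of (1 + k) (- (M^-1%:C^-1 *: c)).
  exact: inverse_ofM ib' ic2.
have -> : 1 + k = - (-1 - k) by rewrite opprB opprK addrC.
by case: ic' => c1 c2; split; rewrite mulrNN.
Qed.

End Norm.

(** * Uniform approximation by polynomials *)

Section Weierstrass.
Variable R : realType.
Implicit Types (f : R -> R) (g d : nat -> R) (x c : R).

(* The Bernstein polynomial [\sum_k g k * 'C(n, k) * 'X^k * (1 - 'X)^(n - k)],
   by Pascal's rule. *)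
Fixpoint bernstein n g : {poly R} :=
  if n is m.+1 then
    'X * bernstein m (fun k => g k.+1) + (1 - 'X) * bernstein m g
  else (g 0%N)%:P.

(** For [x] in [[0, 1]] each recursion step is a convex combination, so the triangle inequality
    carries pointwise error bounds along. *)
Lemma bernstein_dist n g d x c : 0 <= x <= 1 ->
  (forall k, (k <= n)%N -> `|g k - c| <= d k) ->
  `|(bernstein n g).[x] - c| <= (bernstein n d).[x].
Proof.
move=> /andP[x0 x1]; elim: n g d => [|n IHn] g d gd /=; first by rewrite !hornerC gd.
rewrite !hornerE.
have := IHn (fun k => g k.+1) (fun k => d k.+1) (fun k kn => gd k.+1 kn).
have := IHn g d (fun k kn => gd k (leqW kn)).
move: (_.[x]) (_.[x]) (_.[x]) (_.[x]) => p1 p2 p3 p4 h1 h2.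
have -> : x * p2 + (1 - x) * p4 - c = x * (p2 - c) + (1 - x) * (p4 - c) by ring.
rewrite (le_trans (ler_normD _ _))// !normrM (ger0_norm x0).
by rewrite (ger0_norm (_ : 0 <= 1 - x)) ?subr_ge0// lerD ?ler_wpM2l ?subr_ge0.
Qed.

(** Second moment about [c] of the binomial law: squared bias plus variance. The induction varies
    [c], since shifting [k] by one turns [c] into [c - 1]. *)
Lemma bernstein_variance n (e K : R) x c :
  (bernstein n (fun k => e + K * (k%:R - c) ^+ 2)).[x] =
  e + K * ((n%:R * x - c) ^+ 2 + n%:R * x * (1 - x)).
Proof.
elim: n c => [|n IHn] c /=; first by rewrite hornerC; ring.
rewrite !hornerE IHn.
have -> : bernstein n (fun k => e + K * (k.+1%:R - c) ^+ 2) =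
          bernstein n (fun k => e + K * (k%:R - (c - 1)) ^+ 2).
  by congr (bernstein _ _); apply: funext => k; rewrite -natr1; ring.
by rewrite IHn -natr1; ring.
Qed.

Lemma uniformly_continuous_segment f (a b e : R) : continuous f -> 0 < e ->
  exists2 d : R, 0 < d &
    forall s t : R, a <= s <= b -> `|s - t| < d -> `|f s - f t| < e.
Proof.
move=> fc e0.
have /compact_near_coveringP cov := @segment_compact R a b.
(* By compactness it suffices that each point of the segment has a neighbourhood on which all small
   [d] work. *)
have : \forall d \near 0^'+, `[a, b] `<=`
    [set s | forall t, `|s - t| < d -> `|f s - f t| < e].
  apply: cov => s _.
  have e2 : 0 < e / 2 by rewrite divr_gt0.
  have /cvgrPdist_lt/(_ _ e2)/nbhs_ballP[r /= r0 hr] := fc s.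
  have r2 : 0 < r / 2 by rewrite divr_gt0.
  near=> s' d => t /= s't.
  have ss' : `|s - s'| < r / 2.
    by near: s'; apply/nbhs_ballP; exists (r / 2).
  have dr : d < r / 2 by near: d; apply: nbhs_right_lt.
  have h1 : `|f s - f s'| < e / 2 by apply: hr; rewrite /ball /=; lra.
  have h2 : `|f s - f t| < e / 2.
    by apply: hr; rewrite /ball /=; have := ler_distD s' s t; lra.
  by have := ler_distD (f s) (f s') (f t); rewrite (distrC (f s') (f s)); lra.
move=> hd; have [d [d0 dab]] : exists d : R, 0 < d /\ `[a, b] `<=`
    [set s | forall t, `|s - t| < d -> `|f s - f t| < e].
  near (0 : R)^'+ => d; exists d; split; last by near: d.
  by near: d; exact: nbhs_right_gt.
by exists d => // s t sab; apply: dab; rewrite /= in_itv.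
Unshelve. all: by end_near. Qed.

Lemma bounded_segment f (a b : R) : a <= b -> continuous f ->
  exists B : R, forall t : R, a <= t <= b -> `|f t| <= B.
Proof.
move=> ab fc.
have [|c _ hc] := @EVT_max R (fun t => `|f t|) a b ab.
  by apply: continuous_subspaceT => t; apply: cvg_norm; exact: fc.
by exists `|f c| => t tab; apply: hc; rewrite in_itv.
Qed.

Lemma weierstrass01 f (e : R) : continuous f -> 0 < e ->
  exists p : {poly R}, forall t : R, 0 <= t <= 1 -> `|p.[t] - f t| <= e.
Proof.
move=> fc e0; have e2 : 0 < e / 2 by rewrite divr_gt0.
have [d d0 hd] := @uniformly_continuous_segment f 0 1 _ fc e2.
have [B hB] := bounded_segment ler01 fc.
have B0 : 0 <= B by rewrite (le_trans _ (hB 0 _))// lexx ler01.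
(* Chebyshev's argument: nodes within [d] of [t] cost [e / 2], and at the others the crude bound
   [2 B] is at most [K (s - t)^2]. *)
pose K := 2 * B / d ^+ 2; have K0 : 0 <= K by rewrite divr_ge0 ?sqr_ge0// mulr_ge0.
pose n := (Num.trunc (K / e)).+1.
have n0 : 0 < n%:R :> R by rewrite ltr0n.
have Kn : K <= e * n%:R.
  by rewrite -ler_pdivrMl// mulrC ltW// /n truncnS_gt.
exists (bernstein n (fun k => f (k%:R / n%:R))) => t t01.
have := @bernstein_dist n (fun k => f (k%:R / n%:R))
  (fun k => e / 2 + K / n%:R ^+ 2 * (k%:R - n%:R * t) ^+ 2) t (f t) t01.
(* Centring at [n t] removes the bias, leaving [K / n * t (1 - t)], which is at most [e / 2]. *)
rewrite bernstein_variance subrr expr0n /= add0r.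
move=> /(_ _)/le_trans; apply.
  move=> k kn; set s := k%:R / n%:R.
  have s01 : 0 <= s <= 1.
    by rewrite divr_ge0 ?ler0n//= ler_pdivrMr// mul1r ler_nat.
  have -> : K / n%:R ^+ 2 * (k%:R - n%:R * t) ^+ 2 = K * (s - t) ^+ 2.
    by rewrite /s; field; rewrite gt_eqF.
  have [st|dst] := ltP `|s - t| d.
    by have := hd s t s01 st; have := sqr_ge0 (s - t); nra.
  have : d ^+ 2 <= (s - t) ^+ 2.
    by rewrite -[leRHS]real_normK ?num_real// ler_pXn2r// nnegrE ltW.
  move=> dst2.
  have : 2 * B <= K * (s - t) ^+ 2.
    rewrite /K mulrAC ler_pdivlMr ?exprn_gt0//.
    by rewrite ler_wpM2l// ?mulr_ge0.
  have := ler_normB (f s) (f t); have := hB s s01; have := hB t t01; lra.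
move: t01 => /andP[t0 t1].
have -> : K / n%:R ^+ 2 * (n%:R * t * (1 - t)) = K / n%:R * (t * (1 - t)).
  by field; rewrite gt_eqF.
have Kne : K / n%:R <= e by rewrite ler_pdivrMr.
have Kn0 : 0 <= K / n%:R by rewrite divr_ge0 ?(ltW n0).
have : t * (1 - t) <= 2^-1 by nra.
have : 0 <= t * (1 - t) by rewrite mulr_ge0 ?subr_ge0.
nra.
Qed.

Lemma weierstrass f (a b e : R) : a < b -> continuous f -> 0 < e ->
  exists p : {poly R}, forall t : R, a <= t <= b -> `|p.[t] - f t| <= e.
Proof.
move=> ab fc e0; have ba : 0 < b - a by rewrite subr_gt0.
have gc : continuous (fun s => f (a + (b - a) * s)).
  move=> s; apply: (@continuous_comp _ _ _ (fun s => a + (b - a) * s) f);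
    last exact: fc.
  by apply: cvgD; [exact: cvg_cst|apply: cvgM; [exact: cvg_cst|exact: cvg_id]].
have [p hp] := weierstrass01 gc e0.
exists (p \Po ((b - a)^-1 *: ('X - a%:P))) => t /andP[at1 tb].
rewrite horner_comp !hornerE; set s := _ * (t - a).
have -> : f t = f (a + (b - a) * s).
  by rewrite /s mulrA divff ?gt_eqF// mul1r subrKC.
apply: hp; rewrite /s mulr_ge0 ?subr_ge0 ?invr_ge0 ?(ltW ba)//=.
by rewrite mulrC ler_pdivrMr// mul1r lerD2r.
Qed.

Lemma continuous_max0N : continuous (fun t : R => Num.max (- t) 0).
Proof.
move=> t; apply: continuous_max; first exact: cvgN.
exact: cvg_cst.
Qed.

(** The absolute value extends the power continuously to the whole line, as [is_cfc_exists]
    requires, and changes nothing on the spectrum of a positive element. *)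
Lemma continuous_powR_norm (p : R) : 0 <= p -> continuous (fun t : R => `|t| `^ p).
Proof.
rewrite le_eqVlt => /predU1P[<-|p0] t.
  under eq_fun do rewrite powRr0.
  exact: cvg_cst.
have [->|t0] := eqVneq t 0; last first.
  apply: (@continuous_comp _ _ _ (fun t : R => `|t|) (fun u => u `^ p)).
    exact: norm_continuous.
  apply: differentiable_continuous; apply/derivable1_diffP.
  by apply: derivable_powR; rewrite in_itv/= normr_gt0 t0.
rewrite /continuous_at normr0 powR0 ?gt_eqF//; apply/cvgrPdist_lt => e e0.
apply/nbhs_ballP; exists (e `^ p^-1); first by rewrite /= powR_gt0.
move=> s; rewrite /ball /= sub0r normrN => se.
rewrite sub0r normrN ger0_norm ?powR_ge0//.
rewrite -[ltRHS](powRr1 (ltW e0)) -(mulVf (lt0r_neq0 p0)) powRrM.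
by apply: gt0_ltr_powR; rewrite ?nnegrE ?powR_ge0.
Qed.

End Weierstrass.

(** * Continuous functional calculus and positivity *)

Section FunctionalCalculus.
Variables (R : realType) (A : cstarAlgType R).
Implicit Types (a b c h : A) (p q : {poly R}) (f g : R -> R).

Lemma poly_calcD a p q : poly_calc a (p + q) = poly_calc a p + poly_calc a q.
Proof. by rewrite /poly_calc !rmorphD. Qed.

Lemma poly_calcB a p q : poly_calc a (p - q) = poly_calc a p - poly_calc a q.
Proof. by rewrite /poly_calc !rmorphB. Qed.

Lemma poly_calcM a p q : poly_calc a (p * q) = poly_calc a p * poly_calc a q.
Proof. by rewrite /poly_calc !rmorphM. Qed.

Lemma poly_calcC a (t : R) : poly_calc a t%:P = t%:C%:A.
Proof. by rewrite /poly_calc map_polyC horner_algC. Qed.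

Lemma poly_calcX a : poly_calc a 'X = a.
Proof. by rewrite /poly_calc map_polyX horner_algX. Qed.

Lemma poly_calc_comm a p : GRing.comm a (poly_calc a p).
Proof. by rewrite /GRing.comm -{1 4}(poly_calcX a) -!poly_calcM mulrC. Qed.

Lemma poly_calc_intertwine a b c p : b * a = c * b ->
  b * poly_calc a p = poly_calc c p * b.
Proof.
move=> ba; elim/poly_ind: p => [|p t IHp].
  by rewrite -polyC0 !poly_calcC -scalerAr -scalerAl mulr1 mul1r.
rewrite !poly_calcD !poly_calcM !poly_calcX !poly_calcC mulrDr mulrDl.
by rewrite mulrA IHp -mulrA ba mulrA -scalerAr -scalerAl mulr1 mul1r.
Qed.

Lemma self_adjoint_poly_calc a p : self_adjoint a -> self_adjoint (poly_calc a p).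
Proof.
rewrite /self_adjoint => sa; elim/poly_ind: p => [|p t IHp].
  by rewrite -polyC0 poly_calcC cstarZ conjc_real cstar1.
rewrite poly_calcD poly_calcM poly_calcX poly_calcC cstarD cstarM IHp sa.
by rewrite cstarZ conjc_real cstar1 poly_calc_comm.
Qed.

Lemma invertible_inverse a b c : a * b = 1 -> c * a = 1 -> invertible a.
Proof.
move=> ab ca; exists b; split => //.
by have -> : b = c by rewrite -[b]mul1r -ca -mulrA ab mulr1.
Qed.

(** If [w] inverts [a b], then [b w] is a right inverse of [a] and, by commutation, [w b] a left
    one. *)
Lemma invertibleM_comm a b : GRing.comm a b -> invertible (a * b) -> invertible a.
Proof.
move=> cab [w [abw wab]].
by apply: (@invertible_inverse _ (b * w) (w * b)); rewrite ?mulrA// -mulrA -cab.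
Qed.

Lemma invertibleM a b : invertible a -> invertible b -> invertible (a * b).
Proof. by move=> [a' ia] [b' ib]; exists (b' * a'); exact: inverse_ofM. Qed.

Lemma invertible_scalar (z : R[i]) : z != 0 -> invertible (z%:A : A).
Proof.
by move=> z0; exists (z^-1%:A); split;
  rewrite -scalerAl mul1r scalerA ?divff ?mulVf// scale1r.
Qed.

Lemma spectrum_norm a (z : R[i]) : spectrum a z -> normc z <= cnorm a.
Proof. by move=> az; rewrite leNgt; apply/negP => /invertible_resolvent. Qed.

Lemma spectrum_real_norm a (t : R) : spectrum a t%:C -> `|t| <= cnorm a.
Proof. by move=> /spectrum_norm; rewrite normc_real. Qed.

Lemma spectrum_self_adjoint a (z : R[i]) : self_adjoint a -> spectrum a z ->
  z = (complex.Re z)%:C.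
Proof.
case: z => x y sa az; have [->//|y0] := eqVneq y 0.
by case: az; exact: self_adjoint_resolvent.
Qed.

(** By the factor theorem [t - a] is a commuting factor of [p(t) - p(a)], so it is invertible if the
    latter is. *)
Lemma spectrum_poly_calc a p (t : R) :
  spectrum a t%:C -> spectrum (poly_calc a p) (p.[t])%:C.
Proof.
move=> at_ ip; apply: at_; have /factor_theorem[q pq] : root (p - p.[t]%:P) t.
  by rewrite /root !hornerE subrr.
have ta : t%:C%:A - a = poly_calc a (t%:P - 'X).
  by rewrite poly_calcB poly_calcC poly_calcX.
have e : p.[t]%:C%:A - poly_calc a p = (t%:C%:A - a) * poly_calc a q.
  rewrite ta -(poly_calcC a) -poly_calcB -poly_calcM; congr (poly_calc a _).
  by rewrite -[LHS]opprB pq -mulrN opprB mulrC.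
apply: (@invertibleM_comm _ (poly_calc a q)); last by rewrite -e.
by rewrite /GRing.comm ta -!poly_calcM mulrC.
Qed.

(** Split [p - t] into linear factors over the complex numbers: if no root were spectral, [p(a) - t]
    would be a product of invertibles. Self-adjointness makes the root found real. *)
Lemma spectrum_poly_calcP a p (t : R) : self_adjoint a ->
  spectrum (poly_calc a p) t%:C -> exists2 s : R, spectrum a s%:C & p.[s] = t.
Proof.
move=> sa pt; pose q := p - t%:P.
(* For constant [p] any spectral point serves; [cnorm_spectrum] provides one. *)
have [q0|q0] := eqVneq q 0.
  have pE : p = t%:P by apply/eqP; rewrite -subr_eq0 -/q q0.
  by case: (cnorm_spectrum sa) => ?; eexists; try eassumption; rewrite pE hornerC.
have [r rE] := closed_field_poly_normal (map_poly (real_complex R) q).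
have qa : poly_calc a q = poly_calc a p - t%:C%:A by rewrite poly_calcB poly_calcC.
have [z [rz az]] : exists z, root (map_poly (real_complex R) q) z /\ spectrum a z.
  apply: contrapT => nz; apply: pt.
  suff : invertible (poly_calc a q) by move=> /invertibleN; rewrite qa opprB.
  rewrite /poly_calc rE linearZ /=.
  apply: invertibleM.
    by apply: invertible_scalar; rewrite lead_coef_eq0 map_poly_eq0.
  have : forall z, z \in r -> invertible (z%:A - a).
    move=> z zr; apply: contrapT => az; apply: nz; exists z; split => //.
    rewrite rE /root hornerZ horner_prod; apply/eqP; rewrite (big_rem z zr)/=.
    by rewrite hornerXsubC subrr mul0r mulr0.
  elim: r {rE nz} => [|z r IHr] hr.
    by rewrite big_nil rmorph1; exists 1; rewrite mulr1.
  rewrite big_cons rmorphM; apply: invertibleM; last first.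
    by apply: IHr => y yr; apply: hr; rewrite inE yr orbT.
  rewrite rmorphB /= horner_algX horner_algC -opprB; apply: invertibleN.
  by apply: hr; rewrite inE eqxx.
have zE := spectrum_self_adjoint sa az.
exists (complex.Re z); first by rewrite -zE.
move: rz; rewrite zE /root horner_map /= => /eqP/complexI.
by rewrite /q !hornerE => /eqP; rewrite subr_eq0 => /eqP.
Qed.

(** Up to sign, the norm of [p(a)] is a point of its spectrum, hence a value of [p] on the spectrum
    of [a]. *)
Lemma cnorm_poly_calc_le a p (K : R) : self_adjoint a ->
  (forall t : R, spectrum a t%:C -> `|p.[t]| <= K) -> cnorm (poly_calc a p) <= K.
Proof.
move=> sa pK; have sp := self_adjoint_poly_calc p sa.
case: (cnorm_spectrum sp) => /spectrum_poly_calcP[]// s as_ ps.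
  by have := pK s as_; rewrite ps ger0_norm// cnorm_ge0.
by have := pK s as_; rewrite ps normrN ger0_norm// cnorm_ge0.
Qed.

(** The polynomial norm bound passes to the limit; the case [f = g] yields uniqueness of the
    calculus. *)
Lemma is_cfc_dist a f g b c (e : R) : self_adjoint a ->
  is_cfc a f b -> is_cfc a g c ->
  (forall t : R, spectrum a t%:C -> `|f t - g t| <= e) -> cnorm (b - c) <= e.
Proof.
move=> sa fb gc fg; rewrite -subr_le0; apply: le0_small => d d0.
have d4 : 0 < d / 4 by rewrite divr_gt0.
have [p [pf pb]] := fb _ d4; have [q [qg qc]] := gc _ d4.
have : cnorm (poly_calc a (p - q)) <= e + d / 2.
  apply: cnorm_poly_calc_le => // t at_; rewrite hornerD hornerN.
  have := pf t at_; have := qg t at_; have := fg t at_; rewrite !ler_norml; lra.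
rewrite poly_calcB => pq.
have := cdist_tri (poly_calc a p) b c.
have := cdist_tri (poly_calc a q) (poly_calc a p) c.
by rewrite (cdistC b (poly_calc a p)); lra.
Qed.

Lemma is_cfc_unique a f b c : self_adjoint a ->
  is_cfc a f b -> is_cfc a f c -> b = c.
Proof.
move=> sa fb fc; apply: cdist_small => e e0; apply: is_cfc_dist fb fc _ => //.
by move=> t _; rewrite subrr normr0 ltW.
Qed.

Lemma is_cfc_ext a f g b : (forall t : R, spectrum a t%:C -> f t = g t) ->
  is_cfc a f b -> is_cfc a g b.
Proof.
move=> fg fb e e0; have [p [pf pb]] := fb e e0.
by exists p; split => // t at_; rewrite -fg// pf.
Qed.

Lemma is_cfc_poly a p : is_cfc a (fun t => p.[t]) (poly_calc a p).
Proof.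
by move=> e e0; exists p; split => [t _|]; rewrite subrr ?normr0 ?cnorm0 ltW.
Qed.

Lemma is_cfc_id a : is_cfc a id a.
Proof.
rewrite -{2}(poly_calcX a); apply: is_cfc_ext (is_cfc_poly a 'X) => t _.
by rewrite hornerX.
Qed.

Lemma is_cfc_cst a (t : R) : is_cfc a (fun=> t) t%:C%:A.
Proof.
rewrite -(poly_calcC a); apply: is_cfc_ext (is_cfc_poly a _) => s _.
by rewrite hornerC.
Qed.

(** [p(t)] is in the spectrum of [p(a)], so [|p(t)| <= ||p(a)||]; let [p] tend to [f]. *)
Lemma is_cfc_norm a f b (t : R) :
  is_cfc a f b -> spectrum a t%:C -> `|f t| <= cnorm b.
Proof.
move=> fb at_; rewrite -subr_le0; apply: le0_small => e e0.
have e2 : 0 < e / 2 by rewrite divr_gt0.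
have [p [pf pb]] := fb _ e2.
have := spectrum_real_norm (spectrum_poly_calc (p := p) at_).
have := cdist_tri b (poly_calc a p) 0; rewrite !subr0.
by have := pf t at_; rewrite distrC; have := lerB_dist (f t) (p.[t]); lra.
Qed.

Lemma is_cfcD a f g b c : is_cfc a f b -> is_cfc a g c ->
  is_cfc a (fun t => f t + g t) (b + c).
Proof.
move=> fb gc e e0; have e2 : 0 < e / 2 by rewrite divr_gt0.
have [p [pf pb]] := fb _ e2; have [q [qg qc]] := gc _ e2.
exists (p + q); split => [t at_|].
  by have := pf t at_; have := qg t at_; rewrite hornerD !ler_norml; lra.
rewrite poly_calcD opprD addrACA (le_trans (cnormD _ _))//; lra.
Qed.

Lemma is_cfcM a f g b c : is_cfc a f b -> is_cfc a g c ->
  is_cfc a (fun t => f t * g t) (b * c).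
Proof.
move=> fb gc e e0; pose K := cnorm b + cnorm c + 1.
have bK : cnorm b <= K by have := cnorm_ge0 c; rewrite /K; lra.
have cK : cnorm c + 1 <= K by have := cnorm_ge0 b; rewrite /K; lra.
have K0 : 0 < K by have := cnorm_ge0 c; lra.
(* The bound 1 keeps [q] below [K], and [e / (2 K)] splits the product error into two halves. *)
pose d := Num.min 1 (e / (2 * K)).
have d0 : 0 < d by rewrite lt_min ltr01 divr_gt0// mulr_gt0.
have d1 : d <= 1 by rewrite ge_min lexx.
have dK : d * (2 * K) <= e by rewrite -ler_pdivlMr ?mulr_gt0// ge_min lexx orbT.
have [p [pf pb]] := fb _ d0; have [q [qg qc]] := gc _ d0.
exists (p * q); split => [t at_|].
  rewrite hornerM.
  have -> : p.[t] * q.[t] - f t * g t = (p.[t] - f t) * q.[t] + f t * (q.[t] - g t).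
    by ring.
  rewrite (le_trans (ler_normD _ _))// !normrM.
  have h1 := pf t at_; have h2 := qg t at_.
  have h3 := is_cfc_norm fb at_; have h4 := is_cfc_norm gc at_.
  have h5 : `|q.[t]| <= K by have := lerB_dist q.[t] (g t); lra.
  have := ler_pM (normr_ge0 _) (normr_ge0 _) h1 h5.
  have := ler_pM (normr_ge0 _) (normr_ge0 _) (le_trans h3 bK) h2.
  lra.
rewrite poly_calcM; set P := poly_calc a p in pb *; set Q := poly_calc a q in qc *.
have -> : P * Q - b * c = (P - b) * Q + b * (Q - c).
  by rewrite mulrBl mulrBr subrKA.
have h5 : cnorm Q <= K by have := cdist_tri c Q 0; rewrite !subr0; lra.
rewrite (le_trans (cnormD _ _))//.
have := le_trans (cnormM _ _) (ler_pM (cnorm_ge0 _) (cnorm_ge0 _) pb h5).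
have := le_trans (cnormM _ _) (ler_pM (cnorm_ge0 _) (cnorm_ge0 _) bK qc).
lra.
Qed.

Lemma is_cfcN a f b : is_cfc a f b -> is_cfc a (fun t => - f t) (- b).
Proof.
move=> fb e e0; have [p [pf pb]] := fb e e0; exists (- p); split => [t at_|].
  by rewrite hornerN -opprD normrN pf.
by rewrite -sub0r poly_calcB -polyC0 poly_calcC scale0r sub0r -opprD cnormN.
Qed.

Lemma is_cfc_self_adjoint a f b : self_adjoint a -> is_cfc a f b -> self_adjoint b.
Proof.
move=> sa fb; apply: cdist_small => e e0.
have e2 : 0 < e / 2 by rewrite divr_gt0.
have [p [_ pb]] := fb _ e2.
have := cdist_tri (poly_calc a p) (cstar b) b.
rewrite -{1}(self_adjoint_poly_calc p sa) -cstarB cnorm_star cdistC.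
by rewrite (cdistC b (poly_calc a p)); lra.
Qed.

Lemma poly_approx_segment f (M : R) : continuous f -> 0 <= M ->
  exists p_ : nat -> {poly R},
  forall n t, `|t| <= M -> `|(p_ n).[t] - f t| <= n.+1%:R^-1.
Proof.
move=> fc M0.
have /choice[p_ hp] : forall n : nat, exists p : {poly R},
    forall t, `|t| <= M -> `|p.[t] - f t| <= n.+1%:R^-1.
  (* Enlarging by 1 keeps the interval nondegenerate when [M = 0]. *)
  move=> n; have [||p hp] := @weierstrass R f (- (M + 1)) (M + 1) n.+1%:R^-1 _ fc.
  - lra.
  - by rewrite invr_gt0 ltr0n.
  by exists p => t; rewrite ler_norml => tM; apply: hp; lra.
by exists p_.
Qed.

Lemma small_inv (e : R) : 0 < e ->
  exists N, forall n : nat, (N <= n)%N -> n.+1%:R^-1 < e.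
Proof.
move=> e0; exists (Num.trunc e^-1) => n Nn.
rewrite invf_plt ?posrE ?ltr0n// (lt_le_trans (truncnS_gt _))// ler_nat ltnS.
by [].
Qed.

(** Approximate [f] on the interval containing the spectrum; the spectral norm bound makes the
    elements [p_n(a)] a Cauchy sequence. *)
Lemma is_cfc_exists a f : self_adjoint a -> continuous f -> exists b, is_cfc a f b.
Proof.
move=> sa fc; have [p_ hp] := poly_approx_segment fc (cnorm_ge0 a).
have hpa n t : spectrum a t%:C -> `|(p_ n).[t] - f t| <= n.+1%:R^-1.
  by move=> /spectrum_real_norm; exact: hp.
have [b hb] : exists l : A, forall e : R, 0 < e -> exists N : nat, forall n : nat,
    (N <= n)%N -> cnorm (poly_calc a (p_ n) - l) < e.
  apply: cnorm_complete => e e0; have e2 : 0 < e / 2 by rewrite divr_gt0.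
  have [N hN] := small_inv e2; exists N => m n Nm Nn.
  rewrite -poly_calcB; apply: (@le_lt_trans _ _ (m.+1%:R^-1 + n.+1%:R^-1)).
    apply: cnorm_poly_calc_le => // t at_; rewrite hornerD hornerN.
    have := hpa m t at_; have := hpa n t at_; move: m.+1%:R^-1 n.+1%:R^-1 => u v.
    by rewrite !ler_norml; lra.
  by rewrite [ltRHS]splitr ltrD ?hN.
exists b => e e0; have [N hN] := hb e e0; have [N' hN'] := small_inv e0.
exists (p_ (maxn N N')); split.
  by move=> t at_; rewrite (le_trans (hpa _ _ at_))// ltW// hN'// leq_maxr.
by rewrite ltW// hN// leq_maxl.
Qed.

Lemma cfcP a f : (exists b, is_cfc a f b) -> is_cfc a f (cfc a f).
Proof. by move=> h; exact: (@xgetPex _ 0 [set b | is_cfc a f b]). Qed.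

(* Both calculi are limits of the same polynomials. *)
Lemma is_cfc_intertwine a c f b d x : self_adjoint a -> self_adjoint c ->
  continuous f -> x * a = c * x -> is_cfc a f b -> is_cfc c f d -> x * b = d * x.
Proof.
move=> sa sc fc xa fb fd; apply: cdist_small => e e0.
pose M := Num.max (cnorm a) (cnorm c).
have [|p_ hp] := @poly_approx_segment f M fc; first by rewrite le_max cnorm_ge0.
pose d' := e / (2 * (cnorm x + 1)).
have x1 : 0 < cnorm x + 1 by have := cnorm_ge0 x; lra.
have d0 : 0 < d' by rewrite divr_gt0// mulr_gt0.
have [N /(_ N (leqnn N)) hN] := small_inv d0.
have cl a' b' : self_adjoint a' -> cnorm a' <= M -> is_cfc a' f b' ->
    cnorm (poly_calc a' (p_ N) - b') <= d'.
  move=> sa' aM fb'; apply: is_cfc_dist (is_cfc_poly _ _) fb' _ => //.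
  by move=> t /spectrum_real_norm/le_trans/(_ aM)/hp/le_trans; apply; exact: ltW.
have aM : cnorm a <= M by rewrite le_max lexx.
have cM : cnorm c <= M by rewrite le_max lexx orbT.
have h1 := cl a b sa aM fb; have h2 := cl c d sc cM fd.
have := cdist_tri (x * poly_calc a (p_ N)) (x * b) (d * x).
rewrite -mulrBr (poly_calc_intertwine _ xa) -mulrBl.
have dE : d' * (2 * (cnorm x + 1)) = e by rewrite divfK// gt_eqF// mulr_gt0.
rewrite cdistC in h1.
have := le_trans (cnormM _ _) (ler_wpM2l (cnorm_ge0 x) h1).
have := le_trans (cnormM _ _) (ler_wpM2r (cnorm_ge0 x) h2).
by lra.
Qed.

(** * Positive elements *)

Definition positive a :=
  self_adjoint a /\ forall t : R, spectrum a t%:C -> 0 <= t.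

(** For [|t| <= M], the condition [|M - t| <= M] says [0 <= t]. In this norm form positivity passes
    to sums by the triangle inequality. *)
Lemma positive_normP h (M : R) : self_adjoint h -> cnorm h <= M ->
  positive h <-> cnorm (M%:C%:A - h) <= M.
Proof.
move=> hs hM.
have -> : M%:C%:A - h = poly_calc h (M%:P - 'X).
  by rewrite poly_calcB poly_calcC poly_calcX.
split=> [[_ h0]|nM].
  apply: cnorm_poly_calc_le => // t ht; have := h0 t ht.
  have := spectrum_real_norm ht; rewrite !hornerE !ler_norml; lra.
split=> // t /(spectrum_poly_calc (p := M%:P - 'X))/spectrum_real_norm.
by rewrite !hornerE ler_norml; lra.
Qed.

Lemma positiveD a b : positive a -> positive b -> positive (a + b).
Proof.
move=> a0 b0; have [sa _] := a0; have [sb _] := b0.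
have /(positive_normP sa (lexx _)) na := a0.
have /(positive_normP sb (lexx _)) nb := b0.
apply/(@positive_normP _ (cnorm a + cnorm b)); [exact: self_adjointD|exact: cnormD|].
rewrite rmorphD scalerDl opprD addrACA (le_trans (cnormD _ _))//; lra.
Qed.

Lemma positive_sqr h : self_adjoint h -> positive (h ^+ 2).
Proof.
move=> hs; split; first exact: self_adjoint_sqr.
move=> t; rewrite expr2 -{1 2}(poly_calcX h) -poly_calcM => /spectrum_poly_calcP[]//.
by move=> s _ <-; rewrite !hornerE -expr2 sqr_ge0.
Qed.

Lemma is_cfc_positive a f b : self_adjoint a -> is_cfc a f b ->
  (forall t : R, spectrum a t%:C -> 0 <= f t) -> positive b.
Proof.
move=> sa fb f0; have sb := is_cfc_self_adjoint sa fb.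
apply/(positive_normP sb (lexx _)).
apply: (is_cfc_dist sa (is_cfc_cst a (cnorm b)) fb) => t at_.
by have := is_cfc_norm fb at_; have := f0 t at_; rewrite !ler_norml; lra.
Qed.

Lemma spectrum_mulC a b (z : R[i]) : z != 0 ->
  spectrum (a * b) z -> spectrum (b * a) z.
Proof.
move=> z0 ab [w [w1 w2]]; apply: ab.
(* Suggested by the series of [1 / (z - a b)], with the inner powers of [b a] collected into
   [w = 1 / (z - b a)]. *)
exists (z^-1 *: (1 + a * w * b)); split.
  rewrite -scalerAr mulrDr mulr1.
  have -> : (z%:A - a * b) * (a * w * b) = a * ((z%:A - b * a) * w) * b.
    rewrite mulrBl mulrBl mulrBr mulrBl -!scalerAl -!scalerAr !mul1r -!scalerAl.
    by rewrite !mulrA.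
  by rewrite w1 mulr1 subrK scalerA mulVf// scale1r.
rewrite -scalerAl mulrDl mul1r.
have -> : (a * w * b) * (z%:A - a * b) = a * (w * (z%:A - b * a)) * b.
  rewrite !mulrBr mulrBl -!scalerAr !mulr1 -!scalerAl.
  by rewrite !mulrA.
by rewrite w2 mulr1 subrK scalerA mulVf// scale1r.
Qed.

(* Kaplansky: with [f] the negative part of [b^* b] and [c = b f], both [- c^* c]
   and [c c^*] are positive although they have opposite nonzero spectra. *)
Lemma positive_starM b : positive (cstar b * b).
Proof.
set h := cstar b * b; have hs : self_adjoint h := self_adjoint_starM b.
split=> // t0 ht0.
pose f (t : R) := Num.max (- t) 0.
have [F hF] := is_cfc_exists hs (@continuous_max0N R : continuous f).
have Fs := is_cfc_self_adjoint hs hF.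
pose c := b * F; pose E := F * F * F.
have hE : is_cfc h (fun t => f t * f t * f t) E by do 2! apply: is_cfcM => //.
have E0 : positive E.
  by apply: is_cfc_positive hE _ => // t _; rewrite !mulr_ge0// le_max lexx orbT.
(* On the negative part, [t f(t) = - f(t)^2]. *)
have cE : cstar c * c = - E.
  apply: (is_cfc_unique hs (f := fun t => f t * t * f t)).
    rewrite /c cstarM Fs mulrA -(mulrA F) -/h.
    by apply: is_cfcM => //; apply: is_cfcM => //; exact: is_cfc_id.
  apply: is_cfc_ext (is_cfcN hE) => t _; rewrite /f.
  by case: (leP 0 t) => t1; [rewrite max_r|rewrite max_l];
    rewrite ?oppr_le0 ?oppr_ge0 ?(ltW t1)//; ring.
have c2 : positive (c * cstar c + c * cstar c).
  pose S := c + cstar c; pose D := 'i *: (c - cstar c).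
  have sS : self_adjoint S by rewrite /self_adjoint cstarD cstarK addrC.
  have sD : self_adjoint D.
    rewrite /self_adjoint cstarZ cstarB cstarK -opprB scalerN -scaleNr.
    congr (_ *: _); by apply/eqP; rewrite eq_complex /= oppr0 opprK !eqxx.
  have -> : c * cstar c + c * cstar c = S ^+ 2 + D ^+ 2 + E + E.
    rewrite -(opprK E) -cE exprZn sqr_i scaleN1r !expr2.
    rewrite mulrBl !mulrDl !mulrBr !mulrDr.
    move: (c * c) (cstar c * c) (c * cstar c) (cstar c * cstar c) => u v w z.
    rewrite opprB opprB [v - z + _]addrC addrACA [u + w]addrC [w + u + _]addrACA.
    by rewrite subrr addr0 [v + z + _]addrACA subrr addr0 -[RHS]addrA -opprD addrK.
  by do !apply: positiveD => //; exact: positive_sqr.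
have cc t : spectrum (c * cstar c) t%:C -> 0 <= t.
  move=> /(spectrum_poly_calc (p := 'X + 'X)).
  rewrite poly_calcD poly_calcX !hornerE.
  by case: c2 => _ /[apply]; lra.
(* A nonzero [t] would be nonnegative as a point of the spectrum of [c c^*], and nonpositive because
   [- t] lies in the spectrum of [E]. *)
have cs t : spectrum (cstar c * c) t%:C -> t = 0.
  move=> ct; apply/eqP/negPn/negP => t1.
  have tp : 0 <= t.
    by apply/cc/spectrum_mulC; rewrite ?(inj_eq (@complexI R) t 0).
  suff : 0 <= - t by move/eqP: t1; lra.
  case: E0 => _; apply; move: ct; rewrite cE => ct iE; apply: ct.
  have -> : t%:C%:A - - E = - ((- t)%:C%:A - E).
    by rewrite opprB opprK rmorphN scaleNr opprK addrC.
  exact: invertibleN.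
have E00 : cnorm E = 0.
  rewrite -cnormN -cE; have /cnorm_spectrum := self_adjoint_starM c.
  by case=> /cs => [->//|/eqP]; rewrite oppr_eq0 => /eqP.
(* [E = 0] forces [f(t0)^3 = 0], so the negative part of [t0] vanishes. *)
have := is_cfc_norm hE ht0; rewrite E00 normr_le0 !mulf_eq0 !orbb /f => /eqP f0.
have : - t0 <= Num.max (- t0) 0 by rewrite le_max lexx.
by rewrite f0 oppr_le0.
Qed.

End FunctionalCalculus.

(** * Real powers, absolute values and polar factorisation *)

Section Powers.
Variables (R : realType) (A : cstarAlgType R).
Implicit Types (a b c x : A) (s t : R).

Lemma cpowP a t : positive a -> 0 <= t -> is_cfc a (fun u => u `^ t) (cpow a t).
Proof.
move=> [sa a0] t0; apply: cfcP.
have [b fb] := is_cfc_exists sa (continuous_powR_norm t0).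
by exists b; apply: is_cfc_ext fb => u /a0 u0; rewrite ger0_norm.
Qed.

Lemma cpowD a s t : positive a -> 0 <= s -> 0 <= t ->
  cpow a (s + t) = cpow a s * cpow a t.
Proof.
move=> a0 s0 t0; have [sa ha] := a0.
apply: (is_cfc_unique sa (cpowP a0 (addr_ge0 s0 t0))).
apply: is_cfc_ext (is_cfcM (cpowP a0 s0) (cpowP a0 t0)) => u _.
(* The power law at base 0 needs a nonzero total exponent; otherwise both exponents vanish and both
   sides are 1. *)
have [st|st] := eqVneq (s + t) 0.
  have -> : s = 0 by lra.
  have -> : t = 0 by lra.
  by rewrite addr0 powRr0 mulr1.
by rewrite powRD// (negPf st).
Qed.

Lemma cpow_comm a s t : positive a -> 0 <= s -> 0 <= t ->
  GRing.comm (cpow a s) (cpow a t).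
Proof. by move=> a0 s0 t0; rewrite /GRing.comm -!cpowD// addrC. Qed.

Lemma cpow1 a : positive a -> cpow a 1 = a.
Proof.
move=> a0; have [sa ha] := a0; apply: (is_cfc_unique sa (cpowP a0 ler01)).
by apply: is_cfc_ext (is_cfc_id a) => u /ha u0; rewrite powRr1.
Qed.

Lemma cpow_positive a t : positive a -> 0 <= t -> positive (cpow a t).
Proof.
move=> a0 t0; have [sa _] := a0; apply: (is_cfc_positive sa (cpowP a0 t0)) => u _.
exact: powR_ge0.
Qed.

Lemma cpow_intertwine a c x t : positive a -> positive c -> 0 <= t ->
  x * a = c * x -> x * cpow a t = cpow c t * x.
Proof.
move=> a0 c0 t0 xa; have [sa ha] := a0; have [sc hc] := c0.
apply: (is_cfc_intertwine sa sc (continuous_powR_norm t0) xa).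
  by apply: is_cfc_ext (cpowP a0 t0) => u /ha u0; rewrite ger0_norm.
by apply: is_cfc_ext (cpowP c0 t0) => u /hc u0; rewrite ger0_norm.
Qed.

Lemma half_ge0 : 0 <= 2^-1 :> R.
Proof. by rewrite invr_ge0. Qed.

Lemma cpow_half_sqr a : positive a -> cpow a 2^-1 * cpow a 2^-1 = a.
Proof.
move=> a0; rewrite -cpowD// ?half_ge0// -{2}(cpow1 a0); congr cpow.
by rewrite -mulr2n -(mulr_natr 2^-1) mulVf// pnatr_eq0.
Qed.

Lemma cabs_positive x : positive (cabs x).
Proof. exact: cpow_positive (positive_starM x) half_ge0. Qed.

Lemma cabs_sqr x : cabs x * cabs x = cstar x * x.
Proof. exact: cpow_half_sqr (positive_starM x). Qed.

Lemma cabs_intertwine x : x * cabs x = cabs (cstar x) * x.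
Proof.
apply: cpow_intertwine;
  [exact: positive_starM|exact: positive_starM|exact: half_ge0|].
by rewrite cstarK mulrA.
Qed.

Lemma invertible_star x : invertible x -> invertible (cstar x).
Proof.
move=> [y [xy yx]]; exists (cstar y).
by rewrite -!cstarM xy yx cstar1.
Qed.

Lemma cabs_invertible x : invertible x -> invertible (cabs x).
Proof.
move=> ix; apply: (@invertibleM_comm _ _ _ (cabs x)); first by [].
by rewrite cabs_sqr; apply: invertibleM => //; exact: invertible_star.
Qed.

Lemma cpow_invertible a t : positive a -> invertible a -> 0 <= t <= 1 ->
  invertible (cpow a t).
Proof.
move=> a0 ia /andP[t0 t1]; have t2 : 0 <= 1 - t by rewrite subr_ge0.
apply: (@invertibleM_comm _ _ _ (cpow a (1 - t))); first exact: cpow_comm.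
by rewrite -cpowD// subrKC cpow1.
Qed.

(* For [x = u |x|], [d = |x^*|^(1 - alpha)] and [w = u |x|^alpha]. *)
Lemma polar_factor x alpha : invertible x -> 0 <= alpha <= 1 ->
  exists d w, [/\ self_adjoint d, d * w = x,
    d * d = cpow (cabs (cstar x)) (2 * (1 - alpha)) &
    cstar w * w = cpow (cabs x) (2 * alpha)].
Proof.
move=> ix /andP[al0 al1]; have be0 : 0 <= 1 - alpha by rewrite subr_ge0.
set c := cabs x; set c' := cabs (cstar x).
have c0 : positive c := cabs_positive _; have c0' : positive c' := cabs_positive _.
pose d := cpow c' (1 - alpha); pose e := cpow c (1 - alpha).
have [ds _] : positive d := cpow_positive c0' be0.
have be1 : 0 <= 1 - alpha <= 1 by rewrite be0 /= lerBlDr lerDl.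
have [di id_] : invertible d.
  by apply: cpow_invertible => //; apply/cabs_invertible/invertible_star.
have [ei ie] : invertible e by apply: cpow_invertible => //; exact: cabs_invertible.
have xe : x * e = d * x by apply: cpow_intertwine => //; exact: cabs_intertwine.
have dix : di * x = x * ei.
  case: id_ ie => [_ did] [ee _].
  by rewrite -[LHS]mulr1 -ee mulrA -(mulrA di) xe !mulrA did mul1r.
have dis : self_adjoint di by apply: self_adjoint_inverse ds _.
have two t : 2 * t = t + t by ring.
(* [d^-1 x] takes the place of [u |x|^alpha], so [u] itself is never constructed. *)
exists d, (di * x); split => //.
- by rewrite mulrA id_.1 mul1r.
- by rewrite two cpowD.
(* [w^* w = x^* d^-2 x = x^* x e^-2], and [|x|^2 = |x|^(2 alpha) e^2] cancels the inverses without
   negative powers. *)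
rewrite cstarM dis -mulrA dix (mulrA di) dix -!mulrA (mulrA (cstar x)) -cabs_sqr.
rewrite -/c.
have cE : c * c = cpow c (2 * alpha) * (e * e).
  have -> : c * c = cpow c (1 + 1) by rewrite cpowD ?ler01// cpow1.
  have -> : e * e = cpow c (1 - alpha + (1 - alpha)) by rewrite cpowD.
  rewrite -cpowD//; [|exact: mulr_ge0|exact: addr_ge0].
  by have -> : 1 + 1 = 2 * alpha + (1 - alpha + (1 - alpha)) by ring.
case: ie => ee _.
by rewrite cE -!mulrA (mulrA e ei) ee mul1r ee mulr1.
Qed.

End Powers.

(** * Scalar convexity inequalities *)

Section RealInequalities.
Variable R : realType.
Implicit Types u v m n : R.

(** Convexity: [u^m] lies above its tangent at [v]. This is Young's inequality for [u] and
    [v^(m - 1)]; [m = 1] has no finite conjugate exponent and is treated apart. *)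
Lemma powR_tangent u v m : 0 <= u -> 0 <= v -> 1 <= m ->
  0 <= u `^ m - m * v `^ (m - 1) * u + (m - 1) * v `^ m.
Proof.
move=> u0 v0; rewrite le_eqVlt => /predU1P[<-|m1].
  by rewrite subrr mul0r addr0 powRr0 powRr1// !mul1r subrr.
have m0 : 0 < m by lra.
have m10 : 0 < m - 1 by lra.
have mq : m^-1 + (m / (m - 1))^-1 = 1 by field; rewrite !gt_eqF.
have := conjugate_powR u0 (powR_ge0 v (m - 1)) m0 (divr_gt0 m0 m10) mq.
rewrite -powRrM [(m - 1) * _]mulrC divfK ?gt_eqF// -(ler_pM2l m0).
have -> : m * (u `^ m / m + v `^ m / (m / (m - 1))) = u `^ m + (m - 1) * v `^ m.
  by field; rewrite !gt_eqF.
by rewrite mulrA; lra.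
Qed.

(** Young's inequality for the square roots of [u] and [v], with exponents [n] and [n / (n - 1)]. *)
Lemma sqrt_young u v n : 0 <= u -> 0 <= v -> 2 <= n ->
  Num.sqrt (u * v) <=
    n^-1 * u `^ (n / 2) + (n - 1) / n * v `^ (n / (2 * (n - 1))).
Proof.
move=> u0 v0 n2; have n0 : 0 < n by lra.
have n1 : 0 < n - 1 by lra.
rewrite sqrtrM// -!powR12_sqrt//.
have nq : n^-1 + (n / (n - 1))^-1 = 1 by field; rewrite !gt_eqF.
have := conjugate_powR (powR_ge0 u 2^-1) (powR_ge0 v 2^-1) n0 (divr_gt0 n0 n1) nq.
rewrite -!powRrM [2^-1 * n]mulrC.
have -> : 2^-1 * (n / (n - 1)) = n / (2 * (n - 1)) by field; rewrite gt_eqF.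
by rewrite invf_div [_ / n]mulrC [_ * ((n - 1) / n)]mulrC.
Qed.

End RealInequalities.

(** * States *)

Section States.
Variables (R : realType) (A : cstarAlgType R) (g : {scalar A}).
Hypothesis gs : states g.
Implicit Types a b c h : A.
Local Notation Re := (@complex.Re R).

Let g_pos a : 0 <= g (cstar a * a). Proof. by case: gs. Qed.
Let g_1 : g 1 = 1. Proof. by case: gs. Qed.

Lemma state_scalar (z : R[i]) : g z%:A = z.
Proof. by rewrite linearZ /= g_1 mulr1. Qed.

Lemma state_positive c : positive c -> 0 <= g c.
Proof.
move=> c0; rewrite -(cpow_half_sqr c0).
have [sc _] := cpow_positive c0 (half_ge0 R).
by rewrite -{1}sc.
Qed.

Lemma state_ReE c : positive c -> g c = (Re (g c))%:C.
Proof. by move=> /state_positive/ger0_Im; case: (g c) => x y /= ->. Qed.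

Lemma state_Re_ge0 c : positive c -> 0 <= Re (g c).
Proof. by move=> c0; rewrite -ler0c -state_ReE// state_positive. Qed.

Lemma state_Re_le_norm h : self_adjoint h -> Re (g h) <= cnorm h.
Proof.
move=> hs; have : positive ((cnorm h)%:C%:A - h).
  have -> : (cnorm h)%:C%:A - h = poly_calc h ((cnorm h)%:P - 'X).
    by rewrite poly_calcB poly_calcC poly_calcX.
  split=> [|t /spectrum_poly_calcP[]// s /spectrum_real_norm hs' <-].
    exact: self_adjoint_poly_calc.
  by rewrite !hornerE subr_ge0 (le_trans (ler_norm _)).
move=> /state_positive; rewrite raddfB /= state_scalar.
by case: (g h) => x y; rewrite lecE /= subr_ge0 => /andP[].
Qed.

Lemma state_cauchy_schwarz a b :
  normc (g (cstar a * b)) <=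
    Num.sqrt (Re (g (cstar a * a)) * Re (g (cstar b * b))).
Proof.
have expand (z : R[i]) : 0 <= g (cstar a * a) + z * g (cstar a * b)
    + (conjc z * g (cstar b * a) + z * conjc z * g (cstar b * b)).
  have := g_pos (a + z *: b); rewrite cstarD cstarZ mulrDl !mulrDr.
  rewrite -!scalerAr -!scalerAl scalerA !raddfD /= !linearZ /=.
  by rewrite [z * conjc z]mulrC -mulrA.
have := state_Re_ge0 (positive_starM b).
rewrite (state_ReE (positive_starM a)) (state_ReE (positive_starM b)) in expand.
move: expand; set u := Re _; set v := Re _.
case: (g (cstar a * b)) => x y; case: (g (cstar b * a)) => x' y' expand v0.
(* The values at [1] and ['i] are real, which forces [g (b^* a)] to be the conjugate of
   [g (a^* b)]. *)
have e1 := expand 1; have e2 := expand 'i.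
have xx : x' = x.
  by move: e2; rewrite lecE /= => /andP[/eqP + _]; lra.
have yy : y' = - y.
  by move: e1; rewrite lecE /= => /andP[/eqP + _]; lra.
have pos (t : R) : 0 <= u - 2 * t * (x ^+ 2 + y ^+ 2)
    + t ^+ 2 * (x ^+ 2 + y ^+ 2) * v.
  have := expand ((- t)%:C * (x -i* y)); rewrite xx yy lecE /= => /andP[_].
  by congr (0 <= _); ring.
rewrite /= ler_wsqrtr//; set N := _ + _ in pos *.
(* For [v = 0] the expression is affine in [t] and would equal -1 at the chosen point; otherwise
   [t = 1 / v] is the optimal choice. *)
have [v1|v1] := eqVneq v 0.
  rewrite v1 mulr0 leNgt; apply/negP => N0.
  have := pos ((u + 1) / (2 * N)); rewrite v1 mulr0 addr0.
  have -> : 2 * ((u + 1) / (2 * N)) * N = u + 1 by field; rewrite gt_eqF.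
  by lra.
have := pos v^-1.
have -> : u - 2 * v^-1 * N + v^-1 ^+ 2 * N * v = u - N / v by field.
by rewrite subr_ge0 ler_pdivrMr// lt_def v1.
Qed.

(** Apply [g] to the tangent inequality at [l = g(c)]: the affine part is sent to its value at [l],
    which is [l^m]. *)
Lemma state_jensen c m : positive c -> 1 <= m ->
  Re (g c) `^ m <= Re (g (cpow c m)).
Proof.
move=> c0 m1; have m0 : 0 <= m by lra.
have [sc hc] := c0; set l := Re (g c); have l0 : 0 <= l := state_Re_ge0 c0.
pose k := m * l `^ (m - 1).
have fD : is_cfc c (fun u => u `^ m + (- k) * u + (m - 1) * l `^ m)
    (cpow c m + (- k)%:C%:A * c + ((m - 1) * l `^ m)%:C%:A).
  apply: is_cfcD (is_cfc_cst _ _); apply: is_cfcD; first exact: cpowP.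
  by apply: is_cfcM; [exact: is_cfc_cst|exact: is_cfc_id].
have /state_Re_ge0 :
    positive (cpow c m + (- k)%:C%:A * c + ((m - 1) * l `^ m)%:C%:A).
  apply: is_cfc_positive sc fD _ => u /hc u0.
  by rewrite mulNr; exact: powR_tangent.
rewrite -scalerAl mul1r !raddfD /= state_scalar linearZ /= (state_ReE c0) -/l.
case: (g (cpow c m)) => x y /=.
have -> : (- k) * l = - (m * l `^ m).
  rewrite /k mulNr -mulrA [_ * l]mulrC mulr_powRB1//; lra.
by rewrite mul0r subr0; lra.
Qed.

(** The first term stays a state value so that the contributions of [x] and [y] can be added before
    the norm of their sum is taken. *)
Lemma state_term p x q alpha n : invertible x -> 0 <= alpha <= 1 -> 2 <= n ->
  normc (g (p * x * q)) <=
    n^-1 * Re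
      (g (cpow (p * cpow (cabs (cstar x)) (2 * (1 - alpha)) * cstar p) (n / 2)))
    + (n - 1) / n *
      cnorm (cstar q * cpow (cabs x) (2 * alpha) * q) `^ (n / (2 * (n - 1))).
Proof.
move=> ix al n2; have n0 : 0 < n by lra.
have [d [w [sd <- <- <-]]] := polar_factor ix al.
set a := d * cstar p; set b := w * q.
have -> : p * (d * w) * q = cstar a * b by rewrite cstarM cstarK sd !mulrA.
have -> : p * (d * d) * cstar p = cstar a * a by rewrite cstarM cstarK sd !mulrA.
have -> : cstar q * (cstar w * w) * q = cstar b * b by rewrite cstarM !mulrA.
have a0 := state_Re_ge0 (positive_starM a).
have b0 := state_Re_ge0 (positive_starM b).
rewrite (le_trans (state_cauchy_schwarz _ _))// (le_trans (sqrt_young a0 b0 n2))//.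
apply: lerD; rewrite ler_wpM2l ?invr_ge0 ?divr_ge0 ?(ltW n0)//; try lra.
  by apply: state_jensen; [exact: positive_starM|lra].
apply: ge0_ler_powR; rewrite ?nnegrE ?cnorm_ge0//.
  by rewrite divr_ge0// ?mulr_ge0//; lra.
exact: state_Re_le_norm (self_adjoint_starM b).
Qed.

End States.

Theorem theorem2p41 (R : realType) (A : cstarAlgType R)
    (x y p q r s : A) (alpha n : R)
    (hx : invertible x) (hy : invertible y)
    (halpha0 : 0 <= alpha) (halpha1 : alpha <= 1) (hn : 2 <= n) :
  numradius (p * x * q + r * y * s) <=
    n^-1 * cnorm
      (cpow (p * cpow (cabs (cstar x)) (2 * (1 - alpha)) * cstar p) (n / 2)
     + cpow (r * cpow (cabs (cstar y)) (2 * (1 - alpha)) * cstar r) (n / 2))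
    + (n - 1) / n *
      (cnorm (cstar q * cpow (cabs x) (2 * alpha) * q) `^ (n / (2 * (n - 1)))
     + cnorm (cstar s * cpow (cabs y) (2 * alpha) * s) `^ (n / (2 * (n - 1)))).
Proof.
have al : 0 <= alpha <= 1 by rewrite halpha0.
have n0 : 0 < n by lra.
have n2 : 0 <= n / 2 by lra.
have n1 : 0 <= (n - 1) / n by rewrite divr_ge0 ?(ltW n0)//; lra.
set RHS := (X in _ <= X).
(* The supremum of the empty set is 0 by convention, so existence of a state need not be proved. *)
have [E0|/set0P NE] :=
    eqVneq [set normc (g (p * x * q + r * y * s)) | g in states (A := A)] set0.
  rewrite /numradius E0 sup0 addr_ge0// mulr_ge0 ?invr_ge0 ?cnorm_ge0 ?(ltW n0)//.
  by rewrite addr_ge0// powR_ge0.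
apply: ge_sup => // _ [g gst <-].
rewrite raddfD (le_trans (le_normcD _ _))//.
have := state_term gst p q hx al hn; have := state_term gst r s hy al hn.
rewrite /RHS; set B1 := cpow _ (n / 2); set B2 := cpow _ (n / 2).
(* Self-adjointness of both powers allows one norm bound on their sum. *)
have sB (z : A) (t : A) : invertible z -> self_adjoint
    (cpow (t * cpow (cabs (cstar z)) (2 * (1 - alpha)) * cstar t) (n / 2)).
  move=> iz; have [d [_ [sd _ <- _]]] := polar_factor iz al.
  have -> : t * (d * d) * cstar t = cstar (d * cstar t) * (d * cstar t).
    by rewrite cstarM cstarK sd !mulrA.
  by have [] := cpow_positive (positive_starM (d * cstar t)) n2.
have := state_Re_le_norm gst (self_adjointD (sB x p hx) (sB y r hy)).
rewrite raddfD /=; case: (g _) => b1 ?; case: (g _) => b2 ? /=.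
rewrite -(@ler_pM2l _ n^-1) ?invr_gt0//; lra.
Qed.
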